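(* Let $E=\mathbb{Q}(\sqrt{-2})$, $\omega=\sqrt{-2}$ and $\mathfrak{O}=\mathbb{Z}[\omega]$. If a positive Hermitian $\mathfrak{O}$-lattice represents both $\langle 1,1\rangle$ and $\begin{pmatrix}2&-1+\omega\\-1+\overline{\omega}&2\end{pmatrix}$, then it is $2$-universal.
   Context: A Hermitian $\mathfrak{O}$-lattice is a finitely generated $\mathfrak{O}$-submodule $L$ of a finite-dimensional $E$-vector space equipped with a form $H$ that is linear in the first variable, satisfies $H(x,y)=\overline{H(y,x)}$ (bar is complex conjugation), and has $H(L,L)\subseteq\mathfrak{O}$. Its rank is $\dim_E EL$; binary means rank 2. It is positive (definite) if $H(v):=H(v,v)>0$ for all $0\neq v\in L$. Here every lattice is free ($\mathfrak{O}$ is a PID); the Gram matrix of a lattice with basis $v_1,\dots,v_n$ is $M_L=(H(v_i,v_j))$, and a lattice is identified with its Gram matrix. $\langle a_1,\dots,a_n\rangle$ denotes the lattice with diagonal Gram matrix with entries $a_1,\dots,a_n$. $L$ represents $\ell$ if $M_\ell=XM_LX^*$ for some matrix $X$ over $\mathfrak{O}$, where $X^*$ is the conjugate transpose. A positive Hermitian $\mathfrak{O}$-lattice is $2$-universal if it represents all binary positive Hermitian $\mathfrak{O}$-lattices. *)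

(* Defs.v *)
From mathcomp Require Import all_boot all_order all_algebra all_field.

Set Implicit Arguments.
Unset Strict Implicit.
Unset Printing Implicit Defensive.

Import Order.TTheory GRing.Theory Num.Theory.
Local Open Scope ring_scope.
Local Open Scope sesquilinear_scope.

(* The field E = Q(sqrt(-2)) is taken inside the field algC of algebraic
   complex numbers, so that the bar is the library conjugation and 0 < z in
   algC means that z is real and positive. *)

Definition omega : algC := sqrtC (- 2).

Definition OO : {pred algC} := Cint_span [:: 1; omega].

Lemma OOP (z : algC) :
  reflect (exists a b : int, z = a%:~R + b%:~R * omega) (z \in OO).
Proof.
apply: (iffP (Cint_spanP [tuple 1; omega] z)) => [[a ->]|[a [b ->]]].
  exists (a ord0), (a (lift ord0 ord0)).
  by rewrite !big_ord_recl big_ord0 /= addr0 mulrzl.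
exists [ffun i : 'I_2 => if i == ord0 then a else b].
by rewrite !big_ord_recl big_ord0 /= !ffunE /= addr0 mulrzl.
Qed.

(* Since OO is a PID every lattice is free, and a lattice of rank n is given by
   its Gram matrix M in some basis: it is OO^n (row vectors) inside E^n with
   the form H(x, y) = x M y^*, and H(L, L) is contained in OO exactly when M
   has entries in OO. *)
Definition hform n (M : 'M[algC]_n) (x y : 'rV[algC]_n) : algC :=
  (x *m M *m y ^t*) ord0 ord0.

Definition hermitian_lattice n (M : 'M[algC]_n) : Prop :=
  M \is a mxOver OO /\ M = M ^t*.

Definition positive_lattice n (M : 'M[algC]_n) : Prop :=
  hermitian_lattice M /\
  forall v : 'rV[algC]_n, v \is a mxOver OO -> v != 0 -> 0 < hform M v v.

Definition represents m n (L : 'M[algC]_n) (l : 'M[algC]_m) : Prop :=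
  exists2 X : 'M[algC]_(m, n), X \is a mxOver OO & l = X *m L *m X ^t*.

Definition two_universal n (L : 'M[algC]_n) : Prop :=
  positive_lattice L /\
  forall l : 'M[algC]_2, positive_lattice l -> represents L l.

Definition diag_lattice n (a : n.-tuple algC) : 'M[algC]_n :=
  diag_mx (\row_i tnth a i).

Definition mx2 (a b c d : algC) : 'M[algC]_2 :=
  \matrix_(i, j) nth 0 (nth [::] [:: [:: a; b]; [:: c; d]] i) j.

(* Main.v *)
(* The even unimodular lattice in the hypothesis is the Hurwitz order H, viewed
   as a module over OO = Z[i + j] inside H with the form 2 pr_E(x y^-).  A vector
   of norm 1 projects to 0 on it, so L contains <1,1> _|_ H, and it suffices to
   represent every positive l = [a, b; b^-, c] by <1,1> _|_ H.

   If a and c are even, b = 2 pr_E(h) for some h in H with 4 N(h) <= a c: the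
   minimal N(h) exceeds |b|^2/4 by at most 3/4, depending only on b mod 2, and
   the congruence of a c - |b|^2 modulo 4 makes up for it.  The quaternionic
   Hermitian form [a/2, h; h^-, c/2] is then positive semidefinite, and every
   such form is X X^* with X in M_2(H): dividing out the primes of the
   determinant reduces to determinant at most 1, where Hermite reduction over
   the Euclidean order H concludes.  This represents l by H _|_ H.  If b is not
   divisible by omega, one of the two columns of X spans a sublattice of H that
   also embeds in <1,1>; otherwise l has an overlattice of half the determinant.
   If a is odd and c even, the same argument is applied to the sublattice
   generated by omega x and y: since a is odd, exactly one entry of the row of
   omega x is divisible by omega, and the other column can be moved into <1,1>
   in such a way that omega x becomes divisible by omega. *)
Require Import Defs.
From mathcomp Require Import all_boot all_order all_algebra all_field.
From mathcomp Require Import ring zify.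
Import Order.TTheory GRing.Theory Num.Theory.
Local Open Scope ring_scope.

(** * Arithmetic of the Hurwitz order *)

(* [Quat a b c e] is the Hurwitz quaternion [a + b i + c j + e (1 + i + j + k)/2]. *)
Record quat := Quat {qa : int; qb : int; qc : int; qe : int}.

Definition qadd x y := Quat (qa x + qa y) (qb x + qb y) (qc x + qc y) (qe x + qe y).
Definition qscale (m : int) x := Quat (m * qa x) (m * qb x) (m * qc x) (m * qe x).
Definition qconj x := Quat (qa x + qe x) (- qb x) (- qc x) (- qe x).
Definition qmul x y :=
  let: Quat a b c e := x in let: Quat a' b' c' e' := y in
  Quat (a * a' - b * b' - b * c' + c * b' - c * c' - b * e' - e * c' - e * e')
       (a * b' + b * a' - b * c' + c * b' + c * e' + e * b' - e * c')
       (a * c' + c * a' - b * c' + c * b' - b * e' + c * e' + e * b')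
       (a * e' + e * a' + b * c' *+ 2 - c * b' *+ 2 + b * e' - c * e' - e * b'
        + e * c' + e * e').
Definition qtr x : int := 2 * qa x + qe x.
Definition qnorm x : int :=
  qa x ^+ 2 + qb x ^+ 2 + qc x ^+ 2 + qe x ^+ 2 + (qa x + qb x + qc x) * qe x.

Ltac qring :=
  repeat match goal with x : quat |- _ => destruct x end;
  rewrite ?/qtr ?/qnorm ?/qmul ?/qadd ?/qscale ?/qconj /=;
  first [ring | congr Quat; ring].

Lemma qmulA x y z : qmul x (qmul y z) = qmul (qmul x y) z.
Proof. qring. Qed.

Lemma qnormM x y : qnorm (qmul x y) = qnorm x * qnorm y.
Proof. qring. Qed.

Lemma qmul_conj x : qmul x (qconj x) = Quat (qnorm x) 0 0 0.
Proof. qring. Qed.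

Lemma qconjM x y : qconj (qmul x y) = qmul (qconj y) (qconj x).
Proof. qring. Qed.

Lemma qnorm_shift x y t :
  qnorm (qadd y (qmul t x)) = qnorm y + qnorm x * qnorm t + qtr (qmul t (qmul x (qconj y))).
Proof. qring. Qed.

(** Adding [t] times the first vector to the second turns [[a, h; h^-, c]] into a form with the same
    determinant. *)
Lemma disc_shift a c h t :
  a * (c + a * qnorm t + qtr (qmul t h)) - qnorm (qadd h (qscale a (qconj t))) = a * c - qnorm h.
Proof. qring. Qed.

Definition q0 := Quat 0 0 0 0.

Lemma qnorm4 x :
  4 * qnorm x = (2 * qa x + qe x) ^+ 2 + (2 * qb x + qe x) ^+ 2
                + (2 * qc x + qe x) ^+ 2 + qe x ^+ 2.
Proof. qring. Qed.

Lemma qnorm_ge0 x : 0 <= qnorm x.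
Proof.
rewrite -(pmulr_rge0 _ (ltr0n int 4)) /= qnorm4.
by rewrite !addr_ge0 ?sqr_ge0.
Qed.

Lemma qnorm_eq0 x : qnorm x = 0 -> x = q0.
Proof.
move=> x0; have /eqP := qnorm4 x; rewrite x0 mulr0 eq_sym.
rewrite !paddr_eq0 ?addr_ge0 ?sqr_ge0 // !sqrf_eq0.
case: x {x0} => a b c e /= /andP[/andP[/andP[/eqP Ha /eqP Hb] /eqP Hc] /eqP He].
by congr Quat; lia.
Qed.

(** * Euclidean division and Hermite reduction *)

(** If the nearest even multiple of [m] leaves the error [r], an odd one leaves [m - |r|] up to
    sign; the two absolute errors add up to [m]. *)
Lemma round_even_odd (H m : int) : 0 < m ->
  exists n k : int, (H - m * (2 * n)) ^+ 2 + (H - m * (2 * k + 1)) ^+ 2 <= m ^+ 2.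
Proof.
move=> m0; set n := ((H + m) %/ (2 * m))%Z; set r := H - m * (2 * n).
have rB : - m <= r <= m.
  have := divz_eq (H + m) (2 * m); rewrite -/n.
  have := modz_ge0 (H + m) (_ : 2 * m != 0); have := ltz_pmod (H + m) (_ : 0 < 2 * m).
  rewrite /r; lia.
have [r0|r0] := lerP 0 r.
  exists n, n; rewrite -/r (_ : H - _ = r - m); last by rewrite /r; ring.
  nia.
exists n, (n - 1); rewrite -/r.
rewrite (_ : H - m * (2 * (n - 1) + 1) = r + m); last by rewrite /r; ring.
nia.
Qed.

(* Twice a Hurwitz quaternion has integer coordinates in [1, i, j, k], all even
   or all odd.  By [round_even_odd] the squared errors of the even and of the odd
   rounding of [2 h / m] add up to at most 4. *)
Lemma hurwitz_euclid (m : int) h : 0 < m ->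
  exists t, 2 * qnorm (qadd h (qscale m (qconj t))) <= m ^+ 2.
Proof.
move=> m0; case: h => a b c e.
have [n0 [k0 H0]] := @round_even_odd (2 * a + e) _ m0.
have [n1 [k1 H1]] := @round_even_odd (2 * b + e) _ m0.
have [n2 [k2 H2]] := @round_even_odd (2 * c + e) _ m0.
have [n3 [k3 H3]] := @round_even_odd e _ m0.
set h := Quat a b c e.
suff [t Ht] : exists t, 4 * qnorm (qadd h (qscale m t)) <= 2 * m ^+ 2.
  exists (qconj t); have -> : qconj (qconj t) = t by qring.
  by move: (qnorm _) (m ^+ 2) Ht; clear; lia.
pose s (t0 t1 t2 t3 : int) :=
  (2 * a + e - m * t0) ^+ 2 + (2 * b + e - m * t1) ^+ 2
  + (2 * c + e - m * t2) ^+ 2 + (e - m * t3) ^+ 2.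
have [le|lt] := lerP (s (2 * n0) (2 * n1) (2 * n2) (2 * n3)) (2 * m ^+ 2).
  exists (Quat (n3 - n0) (n3 - n1) (n3 - n2) (- (2 * n3))).
  by rewrite qnorm4 (le_trans _ le) // /s /= le_eqVlt; apply/orP; left; apply/eqP; ring.
exists (Quat (k3 - k0) (k3 - k1) (k3 - k2) (- (2 * k3 + 1))).
set t := Quat _ _ _ _.
have -> : 4 * qnorm (qadd h (qscale m t)) =
    s (2 * k0 + 1) (2 * k1 + 1) (2 * k2 + 1) (2 * k3 + 1).
  by rewrite qnorm4 /s /=; ring.
move: lt H0 H1 H2 H3; rewrite /s; do !move: ((_ - _) ^+ 2) => ?.
by move: (m ^+ 2); clear; lia.
Qed.

(** A shift makes [2 N(h) <= a^2]. If then [c < a], swapping the two vectors decreases [a];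
    otherwise the form is reduced. *)
Lemma hermite_induction (P : int -> quat -> int -> Prop) (d : int) :
  (forall a h c, P c (qconj h) a -> P a h c) ->
  (forall a h c t, P a (qadd h (qscale a (qconj t)))
     (c + a * qnorm t + qtr (qmul t h)) -> P a h c) ->
  (forall a h c, 0 <= a <= c -> 2 * qnorm h <= a ^+ 2 ->
     a * c - qnorm h = d -> P a h c) ->
  forall a h c, 0 <= a -> 0 <= c -> 0 <= d -> a * c - qnorm h = d -> P a h c.
Proof.
move=> Psw Psh Pred a h c a0 c0 d0.
have [m] := ubnP `|a|%N; elim: m => // m IH in a h c a0 c0 * => am dE.
have [a_eq0|a_neq0] := eqVneq a 0.
  have hN : qnorm h = 0 by have := qnorm_ge0 h; rewrite a_eq0 in dE; lia.
  by apply: Pred => //; rewrite ?a_eq0 // hN; lia.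
have a_gt0 : 0 < a by lia.
have [t Ht] := hurwitz_euclid a h a_gt0.
have := disc_shift a c h t; rewrite dE; move: Ht (Psh a h c t).
set h' := qadd _ _; set c' := c + _ + _ => Ht Psh' dE'; apply: Psh'.
have Nh' := qnorm_ge0 h'.
have c'0 : 0 <= c'.
  rewrite -(pmulr_rge0 _ a_gt0); lia.
have [ac|ca] := lerP a c'; first by apply: Pred => //; apply/andP.
apply: Psw; apply: IH => //; first lia.
rewrite -dE' [c' * a]mulrC; congr (_ - _); qring.
Qed.

(** A reduced form of determinant 0 has [a^2 <= a c = N(h) <= a^2 / 2], hence [a = 0] and
    [h = 0]. *)
Lemma rank1_decomposition (a : int) h (c : int) : 0 <= a -> 0 <= c -> a * c = qnorm h ->
  exists (g : int) v w, [/\ 0 <= g, a = g * qnorm v, c = g * qnorm w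
                          & h = qscale g (qmul v (qconj w))].
Proof.
move=> a0 c0 acE.
apply: (hermite_induction (fun a h c => exists (g : int) v w,
  [/\ 0 <= g, a = g * qnorm v, c = g * qnorm w
    & h = qscale g (qmul v (qconj w))]) 0) => //; last by rewrite acE subrr.
- move=> {a0 c0 acE}a {}h {}c [g [v [w [g0 -> -> Eh]]]]; exists g, w, v; split=> //.
  have -> : h = qconj (qconj h) by qring.
  rewrite Eh; qring.
- move=> {a0 c0 acE}a {}h {}c t [g [v [w [g0 aE cE hE]]]].
  pose w' := qadd w (qscale (- 1) (qmul t v)).
  have wE : w = qadd w' (qmul t v) by rewrite /w'; qring.
  have hE' : h = qscale g (qmul v (qconj w')).
    have -> : h = qadd (qadd h (qscale a (qconj t))) (qscale (- a) (qconj t)) by qring.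
    rewrite hE aE /w'; qring.
  exists g, v, w'; split=> //.
  have -> : c = c + a * qnorm t + qtr (qmul t h) - a * qnorm t - qtr (qmul t h) by ring.
  rewrite cE {1}wE qnorm_shift aE hE'.
  have -> x : qtr (qmul t (qscale g x)) = g * qtr (qmul t x) by qring.
  ring.
- move=> {a0 c0 acE}a {}h {}c /andP[a0 c0] hN dE.
  have := qnorm_ge0 h => h0.
  have aE : a = 0 by nia.
  have /qnorm_eq0 -> : qnorm h = 0 by rewrite aE in dE; lia.
  exists c, q0, (Quat 1 0 0 0); split; rewrite ?aE /qnorm /qscale /=; try lia.
  by congr Quat; ring.
Qed.

(** * Norms of Hurwitz quaternions *)

(* The [p./2.+1] squares of [0, ..., p./2] are distinct mod [p], and so are the
   [-1 - x^2]: two sets of that size must meet. *)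
Lemma prime_dvd_sum2sq1 (p : nat) : prime p ->
  exists x y : nat, (p %| 1 + x ^ 2 + y ^ 2)%N.
Proof.
move=> pP; have [->|odd_p] := even_prime pP; first by exists 1%N, 0%N.
have inj_sq (i j : 'I_(p./2.+1)) : (i ^ 2 = j ^ 2 %[mod p])%N -> i = j.
  move=> /eqP; wlog ij : i j / (j <= i)%N.
    by move=> W E; have [/W|/ltnW/W W'] := leqP j i; [exact | apply/esym/W'; rewrite eq_sym].
  rewrite eqn_mod_dvd ?leq_sqr // subn_sqr Euclid_dvdM //.
  have pE := odd_double_half p; rewrite odd_p in pE.
  move=> H; apply/val_inj => /=; have := ltn_ord i; have := ltn_ord j.
  by case/orP: H => /dvdn_leq; lia.
pose f (i : 'I_(p./2.+1)) : 'F_p := (i ^ 2)%:R.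
pose g (i : 'I_(p./2.+1)) : 'F_p := - 1 - (i ^ 2)%:R.
have f_inj : injective f.
  by move=> i j /(congr1 val) /=; rewrite !val_Fp_nat // => /inj_sq.
have g_inj : injective g by move=> i j /addrI /oppr_inj /f_inj.
have : ~~ [disjoint [set f i | i : 'I_(p./2.+1)] & [set g i | i : 'I_(p./2.+1)]].
  apply/negP => /setDidPl D.
  have := cardsU [set f i | i : 'I_(p./2.+1)] [set g i | i : 'I_(p./2.+1)].
  have := cardsD [set f i | i : 'I_(p./2.+1)] [set g i | i : 'I_(p./2.+1)].
  rewrite D !card_imset // !card_ord.
  have := subset_leq_card
    (subsetT ([set f i | i : 'I_(p./2.+1)] :|: [set g i | i : 'I_(p./2.+1)])).
  rewrite cardsT card_Fp //; have := odd_double_half p; rewrite odd_p; lia.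
case/pred0Pn => z /andP[/imsetP[x _ ->] /imsetP[y _]]; rewrite /f /g => E.
exists x, y; rewrite (dvdn_pcharf (pchar_Fp pP)) !natrD E.
by apply/eqP; ring.
Qed.

(* The form [p, h; h^-, N(h)/p] with [h = 1 + x i + y j] has rank 1; the content
   [g] of its decomposition divides [p] and the coordinates of [h]. *)
Lemma prime_is_qnorm (p : nat) : prime p -> exists q, qnorm q = p.
Proof.
move=> pP; have [x [y /dvdnP[k E]]] := prime_dvd_sum2sq1 p pP.
have [//||g [v [w [g0 pE _ hE]]]] :=
  rank1_decomposition p (Quat 1 x%:Z y%:Z 0) k (isT : 0 <= p%:Z).
  by rewrite /qnorm /=; lia.
have /eqP : (1 = g * qa (qmul v (qconj w)))%R by move: hE => /(congr1 qa).
rewrite eq_sym => /eqP g1; exists v; rewrite pE.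
have -> : g = 1 by have := congr1 absz g1; rewrite abszM => /eqP; rewrite muln_eq1; lia.
by rewrite mul1r.
Qed.

Lemma qnorm_surjective (n : nat) : exists q, qnorm q = n.
Proof.
have [n0|n0] := posnP n; first by exists q0; rewrite n0.
have [k] := ubnP n; elim: k => // k IH in n n0 *; rewrite ltnS => nk.
have [n1|n1] := leqP n 1; first by exists (Quat 1 0 0 0); rewrite /qnorm /=; lia.
have pP := pdiv_prime n1; have [q qE] := prime_is_qnorm _ pP.
have nE := divnK (pdiv_dvd n).
have [r rE] : exists r, qnorm r = (n %/ pdiv n)%N.
  by have p1 := prime_gt1 pP; apply: IH; nia.
by exists (qmul r q); rewrite qnormM rE qE -PoszM nE.
Qed.

(** The form [[p, h; h^-, k]] has rank 1 and its content [g] is 1 or [p]. If [g = 1], [v] is the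
    factor; otherwise [p] divides [h], and any [q] of norm [p] will do since [p = q q^-]. *)
Lemma prime_left_factor (p : nat) h k : prime p -> qnorm h = p%:Z * k ->
  exists q h', qnorm q = p /\ h = qmul q h'.
Proof.
move=> pP hk; have p1 := prime_gt1 pP.
have k0 : 0 <= k by have := qnorm_ge0 h; rewrite hk pmulr_rge0; lia.
have [//|g [v [w [g0 pE _ hE]]]] := rank1_decomposition p%:Z h k _ k0 (esym hk).
have : (`|g| %| p)%N by rewrite -[p]/(`|p%:Z|%N) pE abszM dvdn_mulr.
have [_ pdiv] := primeP pP; move=> /pdiv /pred2P[] gE.
  have g1 : g = 1 by lia.
  exists v, (qconj w); split; first by rewrite pE g1 mul1r.
  rewrite hE g1; qring.
have [q qE] := prime_is_qnorm p pP; exists q, (qmul (qconj q) (qmul v (qconj w))).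
split=> //; rewrite qmulA qmul_conj qE hE (_ : g = p); last by lia.
qring.
Qed.

(** * Semidefinite binary quaternionic Hermitian forms *)

(* The quaternionic Hermitian matrix [a, h; h^-, c] is [X X^*]. *)
Definition qrep (a : int) (h : quat) (c : int) : Prop :=
  exists x1 x2 y1 y2, [/\ a = qnorm x1 + qnorm x2, c = qnorm y1 + qnorm y2
    & h = qadd (qmul x1 (qconj y1)) (qmul x2 (qconj y2))].

Lemma qrep_swap a h c : qrep c (qconj h) a -> qrep a h c.
Proof.
move=> [x1 [x2 [y1 [y2 [aE cE hE]]]]]; exists y1, y2, x1, x2; split=> //.
have -> : h = qconj (qconj h) by qring.
rewrite hE; qring.
Qed.

Lemma qrep_shift a h c t :
  qrep a (qadd h (qscale a (qconj t))) (c + a * qnorm t + qtr (qmul t h)) ->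
  qrep a h c.
Proof.
move=> [x1 [x2 [y1 [y2 [aE cE hE]]]]].
pose z1 := qadd y1 (qscale (- 1) (qmul t x1)).
pose z2 := qadd y2 (qscale (- 1) (qmul t x2)).
have yE1 : y1 = qadd z1 (qmul t x1) by rewrite /z1; qring.
have yE2 : y2 = qadd z2 (qmul t x2) by rewrite /z2; qring.
have hE' : h = qadd (qmul x1 (qconj z1)) (qmul x2 (qconj z2)).
  have -> : h = qadd (qadd h (qscale a (qconj t))) (qscale (- a) (qconj t)) by qring.
  rewrite hE aE /z1 /z2; clear; qring.
exists x1, x2, z1, z2; split=> //.
have -> : c = c + a * qnorm t + qtr (qmul t h) - a * qnorm t - qtr (qmul t h) by ring.
rewrite cE yE1 yE2 !qnorm_shift aE hE'.
have -> u v : qtr (qmul t (qadd u v)) = qtr (qmul t u) + qtr (qmul t v) by qring.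
ring.
Qed.

Lemma qrep_mul q a h c : qrep a h c -> qrep (qnorm q * a) (qmul q h) c.
Proof.
move=> [x1 [x2 [y1 [y2 [-> -> ->]]]]]; exists (qmul q x1), (qmul q x2), y1, y2.
by split; rewrite ?qnormM ?mulrDr // -!qmulA; qring.
Qed.

(** When reduced, [a^2 / 2 <= a c - N(h) <= 1] gives [a <= 1] and [h = 0]; the diagonal entries are
    norms. *)
Lemma qrep_disc_le1 (a : int) h (c : int) :
  0 <= a -> 0 <= c -> 0 <= a * c - qnorm h <= 1 -> qrep a h c.
Proof.
move=> a0 c0 /andP[d0 d1].
apply: (hermite_induction _ (a * c - qnorm h)) => //;
  [exact: qrep_swap | exact: qrep_shift |].
move: (a * c - _) d0 d1 => d d0 d1 {a0 c0}a {}h {}c /andP[a0 ac] ha dE.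
have h0 := qnorm_ge0 h.
have a1 : a <= 1 by nia.
have hN : qnorm h = 0 by nia.
have [q1 q1E] := qnorm_surjective `|a|%N; have [q2 q2E] := qnorm_surjective `|c|%N.
exists q1, q0, q0, q2; rewrite q1E q2E; split; rewrite ?/(qnorm q0) /=; try lia.
rewrite (qnorm_eq0 h hN); qring.
Qed.

Theorem qrep_psd (a : int) h (c : int) :
  0 <= a -> 0 <= c -> qnorm h <= a * c -> qrep a h c.
Proof.
move=> a0 c0; rewrite -subr_ge0.
have [k] := ubnP (absz (a * c - qnorm h)%R); elim: k => // k IH in a h c a0 c0 *.
rewrite ltnS => dk d0.
have [d1|d1] := lerP (a * c - qnorm h) 1; first by apply: qrep_disc_le1; rewrite ?d0.
have [p pP /dvdnP[m dE]] : exists2 p, prime p & (p %| absz (a * c - qnorm h)%R)%N.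
  by exists (pdiv (absz (a * c - qnorm h)%R)); rewrite ?pdiv_dvd ?pdiv_prime; lia.
have {m dE}[m dE] : exists m : int, a * c - qnorm h = p%:Z * m by exists m%:Z; lia.
have p1 := prime_gt1 pP.
have [m0 mk] : 0 <= m /\ (`|m| < k)%N by move: d0 d1 dk; rewrite dE; clear -p1; nia.
have descent (a' : int) h' (c' : int) : ~~ (p %| `|a'|)%N -> 0 <= a' -> 0 <= c' ->
  a' * c' - qnorm h' = p%:Z * m -> qrep a' h' c'.
  move=> pa a'0 c'0 dE'.
  have [u [v uvE]] : exists u v : int, u * a' + v * p%:Z = 1.
    have [u [v uvE]] := Bezoutz a' p; exists u, v; rewrite uvE.
    by congr Posz; apply/eqP; rewrite -/(coprime _ _) coprime_sym prime_coprime.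
  (* This shift makes the off-diagonal entry divisible by [p = q q^-], hence also
     the last entry, and the form is obtained from one of discriminant [m] by
     multiplying the second row by [q]. *)
  pose t := qconj (qscale (- u) h').
  apply: (qrep_shift _ _ _ t).
  have := disc_shift a' c' h' t; rewrite dE'.
  move: (c' + _ + _) => c1.
  have -> : qadd h' (qscale a' (qconj t)) = qscale (p%:Z * v) h'.
    have -> : p%:Z * v = 1 - u * a' by rewrite -uvE; ring.
    rewrite /t; clear; qring.
  have -> : qnorm (qscale (p%:Z * v) h') = p%:Z * (p%:Z * v ^+ 2 * qnorm h') by clear; qring.
  move=> d1E.
  have c1E : c1 = p%:Z * (u * (m + p%:Z * v ^+ 2 * qnorm h') + v * c1).
    rewrite -[LHS]mul1r -uvE.
    have -> : (u * a' + v * p%:Z) * c1 = u * (a' * c1) + p%:Z * (v * c1) by ring.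
    have -> : a' * c1 = p%:Z * m + p%:Z * (p%:Z * v ^+ 2 * qnorm h') by rewrite -d1E; ring.
    ring.
  move: (_ + v * c1) c1E => c2 c1E.
  have [q qE] := prime_is_qnorm p pP.
  apply: qrep_swap; rewrite c1E -{1}qE.
  have -> : qconj (qscale (p%:Z * v) h') = qmul q (qconj (qmul (qscale v h') q)).
    rewrite qconjM qmulA qmul_conj qE; clear; qring.
  apply: qrep_mul; apply: qrep_swap.
  have -> x : qconj (qconj x) = x by qring.
  have Nh : qnorm (qmul (qscale v h') q) = p%:Z * (v ^+ 2 * qnorm h').
    by rewrite qnormM qE mulrC; congr (_ * _); clear; qring.
  have dE2 : a' * c2 - qnorm (qmul (qscale v h') q) = m.
    apply: (@mulfI _ p%:Z); first by lia.
    by rewrite Nh; move: d1E; rewrite c1E; move: (qnorm h'); clear; lia.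
  have a'1 : 0 < a' by rewrite lt_def a'0 andbT; apply: contraNneq pa => ->; rewrite dvdn0.
  apply: IH => //; rewrite ?dE2 //.
  have := qnorm_ge0 (qmul (qscale v h') q); move: dE2 a'1 m0; clear; nia.
have [pa|pa] := boolP (p %| `|a|)%N; last exact: descent pa a0 c0 dE.
have [pc|pc] := boolP (p %| `|c|)%N; last first.
  apply/qrep_swap/descent => //; rewrite -dE mulrC; congr (_ - _); qring.
have {pa}[a1 aE] : exists a1, a = p%:Z * a1 by move: pa => /dvdnP[r rE]; exists r%:Z; lia.
have {pc}[c1 cE] : exists c1, c = p%:Z * c1 by move: pc => /dvdnP[r rE]; exists r%:Z; lia.
(* Here [p] divides [a] and [c], hence [N(h)]; a left factor [q] of norm [p] can be taken out of the
   first row. *)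
have [|q [h' [qE hE]]] := prime_left_factor p h (p%:Z * a1 * c1 - m) pP.
  by rewrite mulrBr -dE aE cE; ring.
rewrite aE hE -qE; apply: qrep_mul.
have dE' : a1 * c - qnorm h' = m.
  apply: (@mulfI _ p%:Z); first by lia.
  by rewrite mulrBr -dE aE hE qnormM qE; ring.
by apply: IH; rewrite ?dE' //; move: a0 aE p1; clear; nia.
Qed.

(** * The lattice [<1,1> _|_ H] in integer coordinates *)

(* The pair [(m, n)] of integers stands for [m + n omega]; [oscale] is the
   multiplication by [omega]. *)
Definition oadd (x y : int * int) := (x.1 + y.1, x.2 + y.2).
Definition omul (x y : int * int) := (x.1 * y.1 - 2 * (x.2 * y.2), x.1 * y.2 + x.2 * y.1).
Definition oconj (x : int * int) := (x.1, - x.2).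
Definition onorm (x : int * int) : int := x.1 ^+ 2 + 2 * x.2 ^+ 2.
Definition oscale (x : int * int) := (- (2 * x.2), x.1).
Definition odot (u v : (int * int) * (int * int)) :=
  oadd (omul u.1 (oconj v.1)) (omul u.2 (oconj v.2)).
Definition onorm2 (u : (int * int) * (int * int)) : int := onorm u.1 + onorm u.2.

(* [omega] is [i + j], and [qproj x] is twice the orthogonal projection of [x] to
   [Q(omega)]. *)
Definition qomega := Quat 0 1 1 0.
Definition qproj (x : quat) : int * int := (qtr x, qb x + qc x + qe x).

(* [a, b; b^-, c] is represented by the orthogonal sum of [<1,1>] and of the
   Hurwitz order with the form [qproj (x y^-)]. *)
Definition krep (a : int) (b : int * int) (c : int) : Prop :=
  exists u v x y, [/\ a = onorm2 u + 2 * qnorm x, c = onorm2 v + 2 * qnorm y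
    & b = oadd (odot u v) (qproj (qmul x (qconj y)))].

Ltac oring :=
  repeat match goal with x : (_ * _)%type |- _ => destruct x end;
  rewrite ?/onorm2 ?/odot ?/qproj ?/oadd ?/omul ?/oconj ?/onorm ?/oscale /=;
  try congr pair; qring.

Lemma parityP (m : int) : (exists k, m = 2 * k) \/ (exists k, m = 2 * k + 1).
Proof.
by have [k [E|E]] : exists k : int, m = 2 * k \/ m = 2 * k + 1;
  [exists (m %/ 2)%Z; lia | left; exists k | right; exists k].
Qed.

Lemma krep_swap a b c : krep c (oconj b) a -> krep a b c.
Proof.
move=> [u [v [x [y [aE cE bE]]]]]; exists v, u, y, x; split=> //.
have -> : b = oconj (oconj b) by case: b {bE} => ? ?; rewrite /oconj /= opprK.
rewrite bE; clear; oring.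
Qed.

Lemma krep_shift a b c : krep a (oadd b (a, 0)) (c + a + 2 * b.1) -> krep a b c.
Proof.
move=> [u [v [x [y [aE cE bE]]]]].
exists u, ((v.1.1 - u.1.1, v.1.2 - u.1.2), (v.2.1 - u.2.1, v.2.2 - u.2.2)), x,
  (qadd y (qscale (- 1) x)).
have {}bE : b = oadd (oadd (odot u v) (qproj (qmul x (qconj y)))) (- a, 0).
  by rewrite -bE /oadd /= !addr0 addrK; case: b {cE bE}.
have {}cE : c = onorm2 v + 2 * qnorm y - a - 2 * b.1 by rewrite -cE; ring.
by split; rewrite ?cE ?bE ?aE; clear; oring.
Qed.

Lemma krep_omega a b c : krep a b c -> krep (2 * a) (oscale b) c.
Proof.
move=> [u [v [x [y [-> -> ->]]]]].
exists (oscale u.1, oscale u.2), v, (qmul qomega x), y; split=> //; clear; oring.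
Qed.

(** * Embedding sublattices of the Hurwitz order into [<1,1>] *)

Lemma qmul_unit e x y : qnorm e = 1 ->
  qmul (qmul x e) (qconj (qmul y e)) = qmul x (qconj y).
Proof.
move=> e1; rewrite qconjM -qmulA (qmulA e) qmul_conj e1; clear; qring.
Qed.

(* [qe x] is even iff [x] is a Lipschitz quaternion, i.e. lies over F_2 in the
   residue field F_4 of the Hurwitz order at 2.  The hypothesis says that [x] and
   [y] are F_2-dependent in F_4, and the units [1, zeta, zeta^2] act transitively
   on the nonzero elements of F_4. *)
Lemma common_lipschitz x y k : qe (qmul x (qconj y)) = 2 * k ->
  exists e d d', [/\ qnorm e = 1, qe (qmul x e) = 2 * d & qe (qmul y e) = 2 * d'].
Proof.
move=> xyE.
(* With [s = qa + qb - qc] and [r = qe], the hypothesis says that [(s, r)] and [(s', r')] are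
   dependent mod 2. The three units below turn [qe] into [r], [s + r] and [s], the nonzero linear
   forms. *)
have {k xyE}[k xyE] : exists k,
    (qa x + qb x - qc x) * qe y = qe x * (qa y + qb y - qc y) + 2 * k.
  exists (- k - qb x * qc y + qc x * qb y).
  have -> : 2 * (- k - qb x * qc y + qc x * qb y) =
    - (2 * k) - 2 * (qb x * qc y) + 2 * (qc x * qb y) by ring.
  rewrite -xyE; qring.
have zE z : qe (qmul z (Quat 0 0 0 1)) = (qa z + qb z - qc z) + qe z by qring.
have z2E z : qe (qmul z (Quat (- 1) 0 0 1)) = qa z + qb z - qc z by qring.
have oneE z : qe (qmul z (Quat 1 0 0 0)) = qe z by qring.
move: xyE (zE x) (zE y) (z2E x) (z2E y) (oneE x) (oneE y).
move: (qa x + qb x - qc x) (qa y + qb y - qc y) (qe x) (qe y) => s s' r r'.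
case: (parityP s) => [[k1 ->]|[k1 ->]]; case: (parityP s') => [[k2 ->]|[k2 ->]];
case: (parityP r) => [[k3 ->]|[k3 ->]]; case: (parityP r') => [[k4 ->]|[k4 ->]] =>
  E ? ? ? ? ? ?;
have [|[e [e1 xE yE]]] : False \/ exists e, [/\ qnorm e = 1,
    qe (qmul x e) = 2 * (qe (qmul x e) %/ 2)%Z
    & qe (qmul y e) = 2 * (qe (qmul y e) %/ 2)%Z]
  by [left; lia
     | right; exists (Quat 1 0 0 0); split; [by [] | lia | lia]
     | right; exists (Quat (- 1) 0 0 1); split; [by [] | lia | lia]
     | right; exists (Quat 0 0 0 1); split; [by [] | lia | lia]].
all: try by [].
all: by exists e; do 2 eexists; split; eassumption.
Qed.

(* Coordinates of the Lipschitz quaternion [y] (with [qe y = 2 d]) in the basis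
   [omega^-1, omega^-1 k], which is orthonormal for [qproj (x y^-)]. *)
Definition lip d y : (int * int) * (int * int) :=
  ((- (qb y + qc y + 2 * d), qa y + d), (qc y - qb y, d)).

Lemma lip_norm d y : qe y = 2 * d -> onorm2 (lip d y) = 2 * qnorm y.
Proof. by case: y => a b c e /= ->; rewrite /lip; oring. Qed.

Lemma lip_dot d d' x y : qe x = 2 * d -> qe y = 2 * d' ->
  odot (lip d x) (lip d' y) = qproj (qmul x (qconj y)).
Proof. by case: x y => a b c e [a' b' c' e'] /= -> ->; rewrite /lip; oring. Qed.

Lemma embed_I2 x y k : qe (qmul x (qconj y)) = 2 * k ->
  exists u v, [/\ onorm2 u = 2 * qnorm x, onorm2 v = 2 * qnorm y
                & odot u v = qproj (qmul x (qconj y))].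
Proof.
move=> /common_lipschitz[e [d [d' [e1 xE yE]]]].
exists (lip d (qmul x e)), (lip d' (qmul y e)).
by rewrite !lip_norm // (lip_dot _ _ _ _ xE yE) !qnormM e1 !mulr1 qmul_unit.
Qed.

Lemma embed_I2_odd x y k n : qe (qmul x (qconj y)) = 2 * k -> qnorm x = 2 * n + 1 ->
  exists u v, [/\ onorm2 u = qnorm x, onorm2 v = 2 * qnorm y
                & oscale (odot u v) = qproj (qmul x (qconj y))].
Proof.
move=> /common_lipschitz[e [d [d' [e1 xE yE]]]].
rewrite -(qmul_unit _ x y e1); have := qnormM x e; have := qnormM y e.
rewrite e1 !mulr1 => <- <-; move: (qmul x e) (qmul y e) xE yE => {e1}x {}y xE yE nE {e k}.
(* [lip d x] is divisible by [omega] when [qb x - qc x] is even. Otherwise right multiplication by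
   [i] replaces this difference by [qa x], which is even because [N(x)] is odd. *)
wlog [m mE] : d d' x y xE yE nE / exists m, qb x - qc x = 2 * m.
  move=> W; have [[m mE]|[m mE]] := parityP (qb x - qc x).
    by apply: (W d d') => //; exists m.
  pose i := Quat 0 1 0 0; have i1 : qnorm i = 1 by [].
  rewrite -(qmul_unit _ x y i1) -[qnorm x]mulr1 -[qnorm y]mulr1 -i1 -!qnormM.
  apply: (W (- qc x - d) (- qc y - d')).
  - have -> : qe (qmul x i) = - (2 * qc x) - qe x by clear; rewrite /i; qring.
    rewrite xE; ring.
  - have -> : qe (qmul y i) = - (2 * qc y) - qe y by clear; rewrite /i; qring.
    rewrite yE; ring.
  - by rewrite qnormM i1 mulr1.
  have -> : qb (qmul x i) - qc (qmul x i) = qa x by clear; rewrite /i; qring.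
  have [[l ->]|[l lE]] := parityP (qa x); first by exists l.
  exfalso; move: nE; rewrite /qnorm xE lE (_ : qb x = qc x + 2 * m + 1); last by lia.
  by move: (qc x); clear; lia.
(* The first vector is [lip d x] divided by [omega]. *)
exists ((qa x + d, qc x + d + m), (d, m)), (lip d' y).
rewrite lip_norm //; split=> //.
  case: x xE mE {nE} => xa xb xc xe /= -> mE; have -> : xb = xc + 2 * m by lia.
  oring.
case: x xE mE {nE} => xa xb xc xe /= -> mE; have -> : xb = xc + 2 * m by lia.
case: y yE => ya yb yc ye /= ->.
rewrite /lip; oring.
Qed.

(** * Positive binary forms are represented by [<1,1> _|_ H] *)

Lemma qproj_add x y : qproj (qadd x y) = oadd (qproj x) (qproj y).
Proof. oring. Qed.

Lemma qproj_omega x : qproj (qmul qomega x) = oscale (qproj x).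
Proof. rewrite /qomega; oring. Qed.

Lemma oscale_add x y : oscale (oadd x y) = oadd (oscale x) (oscale y).
Proof. oring. Qed.

Lemma oscale_inj : injective oscale.
Proof. by move=> [a b] [c d] [E ->]; congr pair; lia. Qed.

Lemma qnorm_even x k : qnorm x = 2 * k -> exists x', x = qmul qomega x'.
Proof.
case: x => a b c e; rewrite /qnorm /= => xE.
have [l lE] : exists l, e = 2 * l.
  have [//|[l lE]] := parityP e; exfalso; move: xE; rewrite lE.
  case: (parityP a) => [[? ->]|[? ->]]; case: (parityP b) => [[? ->]|[? ->]];
  case: (parityP c) => [[? ->]|[? ->]]; clear; lia.
have [m mE] : exists m, a = c - b - 2 * m.
  have [[m mE]|[m mE]] := parityP (c - b - a); first by exists m; lia.
  exfalso; move: xE; rewrite lE (_ : a = c - b - (2 * m + 1)); last by lia.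
  clear; lia.
exists (Quat (c + l) (m - l) m (b - c)); rewrite lE mE /qomega /qmul /=.
by congr Quat; ring.
Qed.

Lemma onorm_ge0 b : 0 <= onorm b.
Proof. by have := sqr_ge0 b.1; have := sqr_ge0 b.2; rewrite /onorm; lia. Qed.

Lemma krep_even (a c : int) b m : 0 <= a -> 0 <= c -> b.1 = 2 * m + 1 ->
  0 < (2 * a) * (2 * c) - onorm b -> krep (2 * a) b (2 * c).
Proof.
case: b => b1 b2 a0 c0 /= -> d0.
(* For [b2] even, [4 N(h) = |b|^2 + 3] and the determinant is 3 mod 4; for [b2] odd,
   [4 N(h) = |b|^2 + 1] and it is 1 mod 4. Being positive, it covers the excess. *)
have [h [hb hN]] : exists h, qproj h = (2 * m + 1, b2) /\ qnorm h <= a * c.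
  move: d0; rewrite /onorm /=; have [[l ->]|[l ->]] := parityP b2 => d0.
    exists (Quat m l (l - 1) 1); split; first by rewrite /qproj /qtr /=; congr pair; ring.
    by move: d0; rewrite /qnorm /=; clear; lia.
  exists (Quat m l l 1); split; first by rewrite /qproj /qtr /=; congr pair; ring.
  by move: d0; rewrite /qnorm /=; clear; lia.
have [x1 [x2 [y1 [y2 [aE cE hE]]]]] := qrep_psd a h c a0 c0 hN.
rewrite -hb hE qproj_add.
(* The trace of [h] is odd, so exactly one of the two products has even [qe]; that column moves into
   [<1,1>]. *)
wlog [k kE] : x1 x2 y1 y2 aE cE hE / exists k, qe (qmul x1 (qconj y1)) = 2 * k.
  move=> W; have [[k kE]|[k kE]] := parityP (qe (qmul x1 (qconj y1))).
    by apply: W => //; exists k.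
  have -> u v : oadd u v = oadd v u by clear; oring.
  apply: W; rewrite ?aE ?cE ?hE 1?addrC //; first by clear; qring.
  exists (m - qa h - k); move: hb => [+ _].
  have -> : qtr h = 2 * qa h + qe (qmul x1 (qconj y1)) + qe (qmul x2 (qconj y2)).
    by rewrite hE /qtr /qadd /=; ring.
  by rewrite kE; lia.
have [u [v [uE vE uvE]]] := embed_I2 _ _ _ kE.
by exists u, v, x2, y2; split; rewrite ?uvE // ?uE ?vE ?aE ?cE -mulrDr.
Qed.

Lemma krep_odd (a c : int) b m : 0 <= c -> a = 2 * m + 1 -> 0 < a ->
  0 < a * (2 * c) - onorm b -> krep a b (2 * c).
Proof.
case: b => b1 b2 c0 am a0 d0.
(* [h] lifts [omega b], the product of [omega x] and [y]; [2 N(h)] is [|b|^2] or [|b|^2 + 1], at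
   most [2 a c]. *)
have [h [hb hN]] : exists h, qproj h = oscale (b1, b2) /\ qnorm h <= a * c.
  move: d0; rewrite /onorm /=; have [[l ->]|[l ->]] := parityP b1 => d0.
    exists (Quat (- b2) l l 0); split.
      by rewrite /qproj /qtr /oscale /=; congr pair; ring.
    by move: d0; rewrite /qnorm /=; clear; lia.
  exists (Quat (- b2) (l + 1) l 0); split.
    by rewrite /qproj /qtr /oscale /=; congr pair; ring.
  by move: d0; rewrite /qnorm /=; clear; lia.
have [x1 [x2 [y1 [y2 [aE cE hE]]]]] := qrep_psd a h c (ltW a0) c0 hN.
wlog [n nE] : x1 x2 y1 y2 aE cE hE / exists n, qnorm x1 = 2 * n + 1.
  move=> W; have [[k kE]|[k kE]] := parityP (qnorm x1); last first.
    by apply: (W x1 x2 y1 y2) => //; exists k.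
  apply: (W x2 x1 y2 y1); rewrite ?aE ?cE ?hE 1?addrC //; first by clear; qring.
  by exists (m - k); lia.
have [x2' x2E] : exists x2', x2 = qmul qomega x2'.
  apply: (qnorm_even _ (m - n)).
  rewrite (_ : qnorm x2 = a - qnorm x1); last by rewrite aE; ring.
  rewrite am nE; ring.
move: hE; rewrite x2E -qmulA => hE; move: hb; rewrite hE qproj_add qproj_omega => hb.
(* The first coordinates of [omega b] and of the second column's term are even, so this trace is
   even too. *)
have [k kE] : exists k, qe (qmul x1 (qconj y1)) = 2 * k.
  exists (- b2 - qa (qmul x1 (qconj y1)) + (qproj (qmul x2' (qconj y2))).2).
  by have := congr1 fst hb; rewrite /oadd /oscale /= /qtr; lia.
have [u [v [uE vE uvE]]] := embed_I2_odd _ _ _ _ kE nE.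
exists u, v, x2', y2; split; last by apply: oscale_inj; rewrite -hb oscale_add uvE.
  by rewrite aE uE x2E qnormM.
by rewrite vE cE mulrDr.
Qed.

Theorem krep_pos_def (a c : int) b : 0 < a -> 0 < c -> 0 < a * c - onorm b -> krep a b c.
Proof.
have [k] := ubnP `|a|%N; elim: k => // k IH in a b c *; rewrite ltnS => ak a0 c0 d0.
have Hodd m a' b' c' : a' = 2 * m + 1 ->
    0 < a' -> 0 < c' -> 0 < a' * c' - onorm b' -> krep a' b' c'.
  move=> aE a'0 c'0 d'0.
  have [[l lE]|[l lE]] := parityP c'.
    by rewrite lE in c'0 d'0 *; apply: krep_odd aE a'0 d'0; lia.
  (* Both diagonal entries are odd; adding the first vector to the second makes the last one
     even. *)
  apply: krep_shift.
  have -> : c' + a' + 2 * b'.1 = 2 * (l + m + b'.1 + 1) by rewrite lE aE; ring.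
  have d : a' * (2 * (l + m + b'.1 + 1)) - onorm (oadd b' (a', 0)) = a' * c' - onorm b'.
    rewrite lE (_ : 2 * (l + m + b'.1 + 1) = a' + 2 * l + 1 + 2 * b'.1); last
      by rewrite aE; ring.
    clear; oring.
  apply: (krep_odd _ _ _ m) => //; last by rewrite d.
  have := onorm_ge0 (oadd b' (a', 0)); move: d'0; rewrite -d.
  by move: (onorm _) (_ + 1); move: a'0; clear; nia.
have [[a1 aE]|[a1 aE]] := parityP a; last exact: (Hodd a1).
have [[c1 cE]|[c1 cE]] := parityP c; last first.
  apply: krep_swap; apply: (Hodd c1) => //; rewrite mulrC.
  have -> : onorm (oconj b) = onorm b by clear; oring.
  by [].
have [[m bE]|[m bE]] := parityP b.1; last first.
  by rewrite aE cE; apply: krep_even bE _; rewrite -?aE -?cE; lia.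
(* [b] is divisible by [omega]: dividing the first basis vector by [omega] gives an integral
   overlattice with half the determinant. *)
have -> : b = oscale (b.2, - m).
  by case: b bE {d0} => b1 b2 /= ->; rewrite /oscale /=; congr pair; ring.
rewrite aE; apply: krep_omega; apply: IH => //; try lia.
move: d0; rewrite aE /onorm bE /=; clear; lia.
Qed.

(** * Transfer to matrices over [algC] *)

Local Open Scope sesquilinear_scope.

Definition oval (x : int * int) : algC := x.1%:~R + x.2%:~R * omega.

Lemma omega_sqr : omega * omega = - 2.
Proof. by rewrite -expr2 sqrtCK. Qed.

Lemma omega_conj : omega^* = - omega.
Proof.
have : (omega^*) ^+ 2 = omega ^+ 2 by rewrite -rmorphXn /= sqrtCK rmorphN rmorph_nat.
move/eqP; rewrite eqf_sqr => /orP[/eqP/CrealP w_real|/eqP //].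
have := real_exprn_even_ge0 w_real (isT : ~~ odd 2).
by rewrite sqrtCK oppr_ge0 lern0.
Qed.

Lemma oval_inj : injective oval.
Proof.
suff oval0 (a b : int) : oval (a, b) = 0 -> a = 0 /\ b = 0.
  move=> [a b] [c d] E; have [|] := oval0 (a - c) (b - d); last
    by move=> ? ?; congr pair; lia.
  by move: E; rewrite /oval /= !rmorphB /= => /eqP; rewrite -subr_eq0 => /eqP <-; ring.
move=> E; have E' : oval (a, - b) = 0.
  have := congr1 (fun z => z^*) E.
  by rewrite /oval /= rmorph0 rmorphD rmorphM /= !rmorph_int omega_conj rmorphN /= mulrN mulNr.
have a0 : a = 0.
  have /eqP : (a *+ 2)%:~R = 0 :> algC.
    by rewrite -(addr0 0) -{1}E -E' /oval /= rmorphMn rmorphN /=; ring.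
  by rewrite intr_eq0; lia.
split=> //; move: E; rewrite /oval a0 /= add0r => /eqP; rewrite mulf_eq0 intr_eq0.
by rewrite sqrtC_eq0 oppr_eq0 pnatr_eq0 orbF => /eqP.
Qed.

Lemma ovalD x y : oval (oadd x y) = oval x + oval y.
Proof. by rewrite /oval /= !rmorphD /=; ring. Qed.

Lemma ovalM x y : oval (omul x y) = oval x * oval y.
Proof.
rewrite /oval /= rmorphB rmorphD !rmorphM /=.
have -> : (x.1%:~R + x.2%:~R * omega) * (y.1%:~R + y.2%:~R * omega) =
  x.1%:~R * y.1%:~R + (x.1%:~R * y.2%:~R + x.2%:~R * y.1%:~R) * omega
  + x.2%:~R * y.2%:~R * (omega * omega) by ring.
rewrite omega_sqr; ring.
Qed.

Lemma oval_conj x : oval (oconj x) = (oval x)^*.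
Proof. by rewrite /oval rmorphD rmorphM /= !rmorph_int omega_conj rmorphN /=; ring. Qed.

Lemma oval_OO x : oval x \in OO.
Proof. by apply/OOP; exists x.1, x.2. Qed.

Lemma OO_oval z : z \in OO -> exists x, z = oval x.
Proof. by move=> /OOP[a [b ->]]; exists (a, b). Qed.

Lemma oval_int a : oval (a, 0) = a%:~R.
Proof. by rewrite /oval /= mul0r addr0. Qed.

Lemma mx2_eta (M : 'M[algC]_2) : M = mx2 (M 0 0) (M 0 1) (M 1 0) (M 1 1).
Proof.
by apply/matrixP => i j; rewrite mxE; case: i j => [[|[|//]] ?] [[|[|//]] ?] /=;
  congr (M _ _); apply: val_inj.
Qed.

Lemma mx2M a b c d a' b' c' d' : mx2 a b c d *m mx2 a' b' c' d' =
  mx2 (a * a' + b * c') (a * b' + b * d') (c * a' + d * c') (c * b' + d * d').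
Proof.
apply/matrixP => i j; rewrite !mxE !big_ord_recl big_ord0 !mxE /=.
by case: i j => [[|[|//]] ?] [[|[|//]] ?] /=; rewrite addr0.
Qed.

Lemma mx2D a b c d a' b' c' d' : mx2 a b c d + mx2 a' b' c' d' =
  mx2 (a + a') (b + b') (c + c') (d + d').
Proof.
by apply/matrixP => i j; rewrite !mxE; case: i j => [[|[|//]] ?] [[|[|//]] ?].
Qed.

Lemma mx2_adj a b c d : (mx2 a b c d) ^t* = mx2 (a^*) (c^*) (b^*) (d^*).
Proof.
by apply/matrixP => i j; rewrite !mxE; case: i j => [[|[|//]] ?] [[|[|//]] ?].
Qed.

Lemma oval0 : oval (0, 0) = 0.
Proof. exact: oval_int. Qed.

(** * The Hurwitz order as the even unimodular lattice *)

Definition even_lattice : 'M[algC]_2 := mx2 2 (- 1 + omega) (- 1 + omega^*) 2.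

(* Coordinates in the OO-basis [1, - (1 + i + j + k)/2], whose Gram matrix is
   [even_lattice]. *)
Definition coord1 x : int * int := (qa x + qb x - qc x, qc x).
Definition coord2 x : int * int := (- qe x, qc x - qb x).
Definition coordmx x y : 'M[algC]_2 :=
  mx2 (oval (coord1 x)) (oval (coord2 x)) (oval (coord1 y)) (oval (coord2 y)).

Lemma coord_surj s t : exists x, coord1 x = s /\ coord2 x = t.
Proof.
exists (Quat (s.1 + t.2) (s.2 - t.2) s.2 (- t.1)).
by rewrite /coord1 /coord2 /=; case: s t => ? ? [? ?] /=; split; congr pair; ring.
Qed.

Lemma two_oval : 2 = oval (2, 0) :> algC.
Proof. by rewrite oval_int. Qed.

Lemma offdiag_oval : - 1 + omega = oval (- 1, 1).
Proof. by rewrite /oval /= mul1r rmorphN. Qed.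

Lemma offdiag_conj_oval : - 1 + omega^* = oval (- 1, - 1).
Proof. by rewrite omega_conj /oval /= rmorphN /= mulN1r. Qed.

Lemma coordmx_gram x y : coordmx x y *m even_lattice *m (coordmx x y) ^t* =
  mx2 (oval (qproj (qmul x (qconj x)))) (oval (qproj (qmul x (qconj y))))
      (oval (qproj (qmul y (qconj x)))) (oval (qproj (qmul y (qconj y)))).
Proof.
rewrite /coordmx /even_lattice mx2_adj !mx2M offdiag_conj_oval offdiag_oval two_oval.
rewrite -!oval_conj -!ovalM -!ovalD -!ovalM -!ovalD /coord1 /coord2.
by congr mx2; congr oval; oring.
Qed.

(** * Integral matrices and Gram matrices *)

Lemma OO_sum I (r : seq I) (P : pred I) (F : I -> algC) :
  (forall i, P i -> F i \in OO) -> \sum_(i <- r | P i) F i \in OO.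
Proof.
move=> FO; apply: (big_ind (fun z => z \in OO)) => //.
  by rewrite -oval0 oval_OO.
by move=> z t /OO_oval[x ->] /OO_oval[y ->]; rewrite -ovalD oval_OO.
Qed.

Lemma mxOver_OO_mul m n p (M : 'M[algC]_(m, n)) (N : 'M[algC]_(n, p)) :
  M \is a mxOver OO -> N \is a mxOver OO -> M *m N \is a mxOver OO.
Proof.
move=> /mxOverP MO /mxOverP NO; apply/mxOverP => i j; rewrite mxE OO_sum // => k _.
have [x ->] := OO_oval _ (MO i k).
by have [y ->] := OO_oval _ (NO k j); rewrite -ovalM oval_OO.
Qed.

Lemma mxOver_OO_add m n (M N : 'M[algC]_(m, n)) :
  M \is a mxOver OO -> N \is a mxOver OO -> M + N \is a mxOver OO.
Proof.
move=> /mxOverP MO /mxOverP NO; apply/mxOverP => i j; rewrite mxE.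
have [x ->] := OO_oval _ (MO i j).
by have [y ->] := OO_oval _ (NO i j); rewrite -ovalD oval_OO.
Qed.

Lemma mxOver_OO_opp m n (M : 'M[algC]_(m, n)) :
  M \is a mxOver OO -> - M \is a mxOver OO.
Proof.
move=> /mxOverP MO; apply/mxOverP => i j; rewrite mxE.
have [x ->] := OO_oval _ (MO i j).
by rewrite -mulN1r -[- 1]/((- 1)%:~R) -oval_int -ovalM oval_OO.
Qed.

Lemma mxOver_OO_adj m n (M : 'M[algC]_(m, n)) :
  M \is a mxOver OO -> M ^t* \is a mxOver OO.
Proof.
move=> /mxOverP MO; apply/mxOverP => i j; rewrite !mxE.
by have [x ->] := OO_oval _ (MO j i); rewrite -oval_conj oval_OO.
Qed.

Lemma mx2_OO (a b c d : int * int) :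
  mx2 (oval a) (oval b) (oval c) (oval d) \is a mxOver OO.
Proof.
by apply/mxOverP => i j; rewrite !mxE; case: i j => [[|[|//]] ?] [[|[|//]] ?] /=; apply: oval_OO.
Qed.

Lemma adjmxM m n p (M : 'M[algC]_(m, n)) (N : 'M[algC]_(n, p)) :
  (M *m N) ^t* = N ^t* *m M ^t*.
Proof. by rewrite trmx_mul map_mxM. Qed.

Lemma adjmxD m n (M N : 'M[algC]_(m, n)) : (M + N) ^t* = M ^t* + N ^t*.
Proof. by rewrite linearD map_mxD. Qed.

Lemma gram_diag m n (L : 'M[algC]_n) (Z : 'M[algC]_(m, n)) i :
  (Z *m L *m Z ^t*) i i = hform L (row i Z) (row i Z).
Proof.
rewrite /hform -row_mul !mxE; apply: eq_bigr => k _; rewrite !mxE; congr (_ * _).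
Qed.

Lemma gram_diag_ge0 m n (L : 'M[algC]_n) (Z : 'M[algC]_(m, n)) i :
  positive_lattice L -> Z \is a mxOver OO -> 0 <= (Z *m L *m Z ^t*) i i.
Proof.
move=> [_ Lpos] /mxOverP ZO; rewrite gram_diag.
have [->|nz] := eqVneq (row i Z) 0; first by rewrite /hform !mul0mx mxE.
by apply/ltW/Lpos => //; apply/mxOverP => j k; rewrite mxE.
Qed.

Lemma posdef_oval (l : 'M[algC]_2) : positive_lattice l ->
  exists a b c, [/\ l = mx2 a%:~R (oval b) (oval (oconj b)) c%:~R, 0 < a, 0 < c
    & 0 < a * c - onorm b].
Proof.
move=> [[/mxOverP lO lH] lpos].
have real_int z : z \in OO -> z = z^* -> exists a, z = a%:~R.
  move=> /OO_oval[[a b] ->]; rewrite -oval_conj => /oval_inj [bE].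
  by exists a; rewrite -oval_int (_ : b = 0) //; lia.
have lE i j : l i j = (l j i)^* by rewrite {1}lH !mxE.
have [a aE] := real_int _ (lO 0 0) (lE 0 0).
have [c cE] := real_int _ (lO 1 1) (lE 1 1).
have [b bE] := OO_oval _ (lO 0 1).
have lmx : l = mx2 a%:~R (oval b) (oval (oconj b)) c%:~R.
  by rewrite (mx2_eta l) (lE 1 0) bE aE cE oval_conj.
have pos (x y : int * int) : x != (0, 0) \/ y != (0, 0) ->
    0 < (mx2 (oval x) (oval y) 0 0 *m l *m (mx2 (oval x) (oval y) 0 0) ^t*) 0 0.
  move=> xy; rewrite gram_diag; apply: lpos.
    apply/mxOverP => i j; rewrite !mxE /=; case: j => [[|[|//]] ?] /=; exact: oval_OO.
  apply: contraPneq xy => /rowP r0.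
  have := r0 0; have := r0 1; rewrite !mxE /= -oval0 => /oval_inj -> /oval_inj ->.
  by rewrite eqxx; case.
have posE (x y : int * int) a' :
    oadd (omul (oadd (omul x (a, 0)) (omul y (oconj b))) (oconj x))
         (omul (oadd (omul x b) (omul y (c, 0))) (oconj y)) = (a', 0) ->
    x != (0, 0) \/ y != (0, 0) -> 0 < a'.
  move=> E /pos; rewrite lmx mx2_adj !mx2M mxE /= -!oval_int -!oval_conj.
  by rewrite -!ovalM -!ovalD -!ovalM -!ovalD E oval_int ltr0z.
have a0 : 0 < a.
  apply: (posE (1, 0) (0, 0)); last by left.
  clear; oring.
exists a, b, c; split=> //.
  apply: (posE (0, 0) (1, 0)); last by right.
  clear; oring.
(* The vector [(b^-, -a)] has norm [a (a c - |b|^2)]. *)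
rewrite -(pmulr_rgt0 _ a0); apply: (posE (oconj b) (- a, 0)).
  clear; oring.
by right; apply: contraTneq a0 => -[/eqP]; rewrite oppr_eq0 => /eqP ->.
Qed.

(** * Orthogonality of the two sublattices and conclusion *)

Lemma orthogonal_sublattices n (L : 'M[algC]_n) (X Y : 'M[algC]_(2, n)) :
  positive_lattice L -> X \is a mxOver OO -> Y \is a mxOver OO ->
  X *m L *m X ^t* = 1%:M -> Y *m L *m Y ^t* = even_lattice -> X *m L *m Y ^t* = 0.
Proof.
move=> Lpos XO YO XE YE; have [[LO LH] _] := Lpos.
set C := _ *m _.
(* [X - S Y] is the projection of [X] orthogonal to [Y]; its Gram matrix
   [1 - S B S^*] is nonnegative on the diagonal although the norms of the rows
   of [S] are even. *)
pose D := mx2 2 (1 - omega) (1 - omega^*) 2.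
have DB : D *m even_lattice = 1%:M.
  rewrite /D /even_lattice mx2M omega_conj (mx2_eta 1%:M) !mxE /=.
  by have := omega_sqr => w2; congr mx2; ring: w2.
pose S := C *m D.
have CE : C = S *m even_lattice by rewrite /S -mulmxA DB mulmx1.
have SO : S \is a mxOver OO.
  apply: mxOver_OO_mul; first by rewrite !mxOver_OO_mul ?mxOver_OO_adj.
  have -> : D = mx2 (oval (2, 0)) (oval (1, - 1)) (oval (1, 1)) (oval (2, 0)).
    by rewrite /D !oval_int omega_conj /oval /= !rmorphN /= !mul1r opprK mulN1r.
  exact: mx2_OO.
have BH : even_lattice ^t* = even_lattice.
  by rewrite /even_lattice mx2_adj offdiag_conj_oval offdiag_oval two_oval -!oval_conj.
have CH : Y *m L *m X ^t* = even_lattice *m S ^t*.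
  by rewrite -[in RHS]BH -adjmxM -CE /C !adjmxM trmxCK -LH mulmxA.
have ZE : (X - S *m Y) *m L *m (X - S *m Y) ^t* = 1%:M - S *m even_lattice *m S ^t*.
  rewrite linearB /= map_mxB adjmxM !mulmxBl !mulmxBr XE.
  rewrite !mulmxA -/C -!(mulmxA S) CH YE CE.
  by rewrite !mulmxA subrr subr0.
have /mxOverP Sij := SO.
have [s00 s00E] := OO_oval _ (Sij 0 0); have [s01 s01E] := OO_oval _ (Sij 0 1).
have [s10 s10E] := OO_oval _ (Sij 1 0); have [s11 s11E] := OO_oval _ (Sij 1 1).
have [x [x1 x2]] := coord_surj s00 s01; have [y [y1 y2]] := coord_surj s10 s11.
have SE : S = coordmx x y by rewrite (mx2_eta S) s00E s01E s10E s11E -x1 -x2 -y1 -y2.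
have ZO : X - S *m Y \is a mxOver OO.
  by apply: mxOver_OO_add => //; apply/mxOver_OO_opp/mxOver_OO_mul.
(* A diagonal entry is [1 - 2 N(z)], nonnegative only for [z = 0]. *)
have norm0 z : 0 <= (1 : algC) - oval (qproj (qmul z (qconj z))) -> z = q0.
  have -> : qproj (qmul z (qconj z)) = (2 * qnorm z, 0) by oring.
  rewrite oval_int -(rmorph1 intr) -rmorphB ler0z => z1.
  by apply: qnorm_eq0; have := qnorm_ge0 z; lia.
have := gram_diag_ge0 _ _ _ _ 0 Lpos ZO; have := gram_diag_ge0 _ _ _ _ 1 Lpos ZO.
rewrite ZE SE coordmx_gram !mxE /= => /norm0 yE /norm0 xE.
rewrite CE SE xE yE (_ : coordmx q0 q0 = 0) ?mul0mx // /coordmx.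
by apply/matrixP => i j; rewrite !mxE; case: i j => [[|[|//]] ?] [[|[|//]] ?]; apply: oval0.
Qed.

Theorem theorem9 (n : nat) (L : 'M[algC]_n) :
  positive_lattice L ->
  represents L (diag_lattice [tuple 1; 1]) ->
  represents L (mx2 2 (- 1 + omega) (- 1 + omega^*) 2) ->
  two_universal L.
Proof.
move=> Lpos [X XO XE] [Y YO YE]; split=> // l /posdef_oval[a [b [c [-> a0 c0 d0]]]].
have {}XE : X *m L *m X ^t* = 1%:M.
  rewrite -XE; apply/matrixP => i j; rewrite !mxE.
  by case: i j => [[|[|//]] ?] [[|[|//]] ?].
have XY := orthogonal_sublattices _ _ _ _ Lpos XO YO XE (esym YE).
have YX : Y *m L *m X ^t* = 0.
  have [[_ LH] _] := Lpos.
  have := congr1 (fun M => M ^t*) XY; rewrite !adjmxM trmxCK -LH mulmxA => ->.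
  by rewrite trmx0 map_mx0.
have [u [v [x [y [aE cE bE]]]]] := krep_pos_def a c b a0 c0 d0.
pose U := mx2 (oval u.1) (oval u.2) (oval v.1) (oval v.2).
exists (U *m X + coordmx x y *m Y).
  by apply: mxOver_OO_add; apply: mxOver_OO_mul => //; apply: mx2_OO.
set V := coordmx x y.
(* The cross terms vanish by orthogonality, leaving the [<1,1>] part and the Hurwitz part. *)
have -> : (U *m X + V *m Y) *m L *m (U *m X + V *m Y) ^t* =
    U *m (X *m L *m X ^t*) *m U ^t* + V *m (Y *m L *m Y ^t*) *m V ^t*
    + (V *m (Y *m L *m X ^t*) *m U ^t* + U *m (X *m L *m Y ^t*) *m V ^t*).
  rewrite adjmxD !adjmxM !mulmxDl !mulmxDr !mulmxA -!addrA; congr (_ + _).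
  by rewrite addrA addrC [X in _ + X]addrC.
rewrite XE XY YX -YE !mulmx0 !mul0mx !addr0 mulmx1 coordmx_gram mx2_adj mx2M mx2D.
rewrite -!oval_int -!oval_conj -!ovalM -!ovalD.
by congr mx2; congr oval; rewrite ?aE ?cE ?bE; clear; oring.
Qed.
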